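(* Let $\mathbb{X}$ be a complex Banach space. Then a strict contraction $T$ on $\mathbb{X}$ dilates to an isometry if and only if the function $A_T:\mathbb{X}\to[0,\infty)$ given by $A_T(x)=(\|x\|^2-\|Tx\|^2)^{1/2}$ defines a norm on $\mathbb{X}$. Moreover, (in that case) the minimal isometric dilation space of $T$ is isometrically isomorphic to $\mathbb{X}\oplus_2\ell_2(\mathbb{X}_0)$, where $\mathbb{X}_0$ is the Banach space $(\mathbb{X},A_T)$.
   Context: A strict contraction is a bounded linear operator with $\|T\|<1$. An isometry is a linear norm-preserving map (not necessarily onto). $\mathbb{Y}_1\oplus_2\mathbb{Y}_2$ is the direct sum with norm $\|(y_1,y_2)\|=(\|y_1\|^2+\|y_2\|^2)^{1/2}$; $\ell_2(\mathbb{Y})$ is the space of square-summable sequences in $\mathbb{Y}$ with norm $(\sum\|y_n\|^2)^{1/2}$. Isometric dilation. Let $T$ be a contraction on a Banach space $\mathbb{X}$. An isometry $V$ on a Banach space $\widetilde{\mathbb{X}}$ is an isometric dilation of $T$ (one says $T$ dilates to $V$) if there are a linear isometry $W:\mathbb{X}\to\widetilde{\mathbb{X}}$ and a closed linear subspace $\mathbb{L}\subseteq\widetilde{\mathbb{X}}$ such that $\widetilde{\mathbb{X}}=W(\mathbb{X})\oplus_2\mathbb{L}$ (every $u\in\widetilde{\mathbb{X}}$ is uniquely $u=w+l$ with $w\in W(\mathbb{X})$, $l\in\mathbb{L}$, and $\|u\|^2=\|w\|^2+\|l\|^2$) and, with $\widehat{W}:=W:\mathbb{X}\to W(\mathbb{X})$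 and $\widehat{T}:=\widehat{W}T\widehat{W}^{-1}$ on $W(\mathbb{X})$, one has $q(\widehat{T})=P_{W(\mathbb{X})}\,q(V)|_{W(\mathbb{X})}$ for all $q\in\mathbb{C}[z]$, where $P_{W(\mathbb{X})}(w+l)=w$ is the norm-one projection of $\widetilde{\mathbb{X}}$ onto $W(\mathbb{X})$. The dilation is minimal if $\widetilde{\mathbb{X}}=\overline{\mathrm{span}}\{V^nWx: x\in\mathbb{X},\,n\ge 0\}$; the space $\widetilde{\mathbb{X}}$ of a minimal dilation is the minimal isometric dilation space. *)

(* Defs.v *)
(* The complex scalars are R[i], for a realType R. *)
From HB Require Import structures.
From mathcomp Require Import all_boot all_order all_algebra.
From mathcomp Require Import all_classical all_reals all_analysis.
From mathcomp Require Import complex.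
From mathcomp Require Import ring.

Set Implicit Arguments.
Unset Strict Implicit.
Unset Printing Implicit Defensive.

Import Order.TTheory GRing.Theory Num.Theory.
Import numFieldNormedType.Exports.

Local Open Scope classical_set_scope.
Local Open Scope complex_scope.
Local Open Scope ring_scope.

(* In a normedModType over R[i] the norm `|x| is an element of R[i] (with zero
   imaginary part); rnorm x is the same number as an element of R. *)
Definition rnorm (R : realType) (V : normedModType R[i]) (x : V) : R :=
  complex.Re `|x|.

Section rnorm_theory.
Context (R : realType) (V : normedModType R[i]).
Implicit Types (x y : V) (a : R[i]).

Lemma rnormE x : `|x| = (rnorm x)%:C.
Proof.
rewrite /rnorm; have := normr_ge0 x.
by case: (`|x|) => p q; rewrite lecE /= => /andP[/eqP -> _].
Qed.

Lemma rnorm_ge0 x : 0 <= rnorm x.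
Proof. by rewrite -ler0c -rnormE. Qed.

Lemma rnorm0 : rnorm (0 : V) = 0.
Proof. by rewrite /rnorm normr0. Qed.

Lemma ler_rnormD x y : rnorm (x + y) <= rnorm x + rnorm y.
Proof.
by have := ler_normD x y; rewrite !rnormE -rmorphD lecE /= => /andP[].
Qed.

Lemma rnormZ a x : rnorm (a *: x) = complex.Re `|a| * rnorm x.
Proof.
by rewrite {1}/rnorm normrZ [`|x|]rnormE normc_def -rmorphM.
Qed.

Lemma rnorm_eq0 x : rnorm x = 0 -> x = 0.
Proof. by move=> x0; apply/normr0_eq0; rewrite rnormE x0. Qed.

End rnorm_theory.

Definition is_norm (R : realType) (V : lmodType R[i]) (N : V -> R) : Prop :=
  [/\ forall x, 0 <= N x,
      forall x, N x = 0 -> x = 0,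
      forall (a : R[i]) x, N (a *: x) = complex.Re `|a| * N x &
      forall x y, N (x + y) <= N x + N y].

(* V with its linear structure, normed by N instead of its own norm (if any). *)
Definition renormed (R : realType) (V : lmodType R[i]) (N : V -> R)
  (hN : is_norm N) : Type := V.

Section renormed_normedMod.
Context (R : realType) (V : lmodType R[i]) (N : V -> R) (hN : is_norm N).

HB.instance Definition _ := GRing.Lmodule.on (renormed hN).

Let nm (x : renormed hN) : R[i] := (N x)%:C.

Let nmD x y : nm (x + y) <= nm x + nm y.
Proof. by have [_ _ _ D] := hN; rewrite -rmorphD lecR; exact: D. Qed.

Let nmZ (a : R[i]) x : nm (a *: x) = `|a| * nm x.
Proof.
have [_ _ Z _] := hN; rewrite /nm [N _]Z.
by rewrite normc_def -rmorphM.
Qed.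

Let nm0 x : nm x = 0 -> x = 0.
Proof. by have [_ E _ _] := hN; case=> /E. Qed.

HB.instance Definition _ := Lmodule_isNormed.Build R[i] (renormed hN) nmD nmZ nm0.

End renormed_normedMod.

Lemma sqrt_minkowski2 (R : realType) (a b c d : R) :
  0 <= a -> 0 <= b -> 0 <= c -> 0 <= d ->
  Num.sqrt ((a + c) ^+ 2 + (b + d) ^+ 2) <=
  Num.sqrt (a ^+ 2 + b ^+ 2) + Num.sqrt (c ^+ 2 + d ^+ 2).
Proof.
move=> a0 b0 c0 d0.
set p := Num.sqrt (a ^+ 2 + _); set q := Num.sqrt (c ^+ 2 + _).
have p0 : 0 <= p by exact: sqrtr_ge0.
have q0 : 0 <= q by exact: sqrtr_ge0.
have p2 : p ^+ 2 = a ^+ 2 + b ^+ 2 by rewrite sqr_sqrtr// addr_ge0// sqr_ge0.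
have q2 : q ^+ 2 = c ^+ 2 + d ^+ 2 by rewrite sqr_sqrtr// addr_ge0// sqr_ge0.
have pq : a * c + b * d <= p * q.
  rewrite -(@ler_pXn2r _ 2)// ?nnegrE ?mulr_ge0 ?addr_ge0 ?mulr_ge0//.
  rewrite exprMn p2 q2 -subr_ge0.
  rewrite [leRHS](_ : _ = (a * d - b * c) ^+ 2) ?sqr_ge0//; ring.
rewrite -(@ler_pXn2r _ 2)// ?nnegrE ?addr_ge0 ?sqrtr_ge0//.
rewrite sqr_sqrtr ?addr_ge0 ?sqr_ge0//.
rewrite [leRHS]sqrrD p2 q2 -subr_ge0.
rewrite [leRHS](_ : _ = 2 * (p * q - (a * c + b * d))); last by ring.
by rewrite mulr_ge0// subr_ge0.
Qed.

(* The direct sum Y1 (+)_2 Y2: an alias of the product, which carries the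
   norm sqrt (|y1|^2 + |y2|^2) and not the maximum norm of Y1 * Y2. *)
Definition oplus2 (R : realType) (Y1 Y2 : normedModType R[i]) : Type :=
  (Y1 * Y2)%type.

Section oplus2_normedMod.
Context (R : realType) (Y1 Y2 : normedModType R[i]).

HB.instance Definition _ := GRing.Lmodule.copy (oplus2 Y1 Y2) (Y1 * Y2)%type.

Definition oplus2_norm (u : oplus2 Y1 Y2) : R :=
  Num.sqrt (rnorm u.1 ^+ 2 + rnorm u.2 ^+ 2).

Let nm (u : oplus2 Y1 Y2) : R[i] := (oplus2_norm u)%:C.

Let nmD u v : nm (u + v) <= nm u + nm v.
Proof.
rewrite -rmorphD lecR /oplus2_norm.
apply: le_trans (sqrt_minkowski2 _ _ _ _); rewrite ?rnorm_ge0//.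
by rewrite ler_sqrt ?addr_ge0 ?sqr_ge0// lerD// lerXn2r// ?nnegrE
  ?addr_ge0 ?rnorm_ge0// ler_rnormD.
Qed.

Let nmZ (a : R[i]) u : nm (a *: u) = `|a| * nm u.
Proof.
rewrite /nm /oplus2_norm /= !rnormZ !exprMn -mulrDr sqrtrM ?sqr_ge0//.
rewrite normc_def/= sqrtr_sqr ger0_norm ?sqrtr_ge0//.
by rewrite rmorphM.
Qed.

Let nm0 u : nm u = 0 -> u = 0.
Proof.
case=> /eqP; rewrite sqrtr_eq0 => h.
have : rnorm u.1 ^+ 2 + rnorm u.2 ^+ 2 == 0.
  by rewrite eq_le h addr_ge0 ?sqr_ge0.
rewrite paddr_eq0 ?sqr_ge0// !sqrf_eq0 => /andP[/eqP u1 /eqP u2].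
by case: u u1 u2 {h} => u1 u2 /= /rnorm_eq0 -> /rnorm_eq0 ->.
Qed.

HB.instance Definition _ :=
  Lmodule_isNormed.Build R[i] (oplus2 Y1 Y2) nmD nmZ nm0.

End oplus2_normedMod.

Section square_summable.
Context (R : realType) (Y : normedModType R[i]).
Implicit Types f g : nat -> Y.

Definition sqseries f : R^nat := series (fun n => rnorm (f n) ^+ 2).

Definition square_summable : {pred nat -> Y} := mem [set f | cvgn (sqseries f)].

Definition l2_norm f : R := Num.sqrt (limn (sqseries f)).

Lemma sqseries_ge0 f n : 0 <= sqseries f n.
Proof. by rewrite /sqseries /series /= sumr_ge0// => i _; exact: sqr_ge0. Qed.

Lemma sqseries_nd f : nondecreasing_seq (sqseries f).
Proof. by apply: nondecreasing_series => n _ _; exact: sqr_ge0. Qed.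

Lemma sqseries_lim_ge0 f : f \in square_summable -> 0 <= limn (sqseries f).
Proof.
move=> /set_mem cf; apply: limr_ge => //.
by apply: nearW => n; exact: sqseries_ge0.
Qed.

Lemma sqrt_sqseries_le f n : f \in square_summable ->
  Num.sqrt (sqseries f n) <= l2_norm f.
Proof.
move=> /[dup] fs /set_mem cf; rewrite ler_sqrt ?sqseries_lim_ge0//.
exact: (nondecreasing_cvgn_le (sqseries_nd f)).
Qed.

Lemma sqrt_sqseriesD f g n :
  Num.sqrt (sqseries (f + g) n) <=
  Num.sqrt (sqseries f n) + Num.sqrt (sqseries g n).
Proof.
elim: n => [|n IH]; first by rewrite /sqseries /series /= !big_geq// sqrtr0 addr0.
have S h : sqseries h n.+1 = (Num.sqrt (sqseries h n)) ^+ 2 + rnorm (h n) ^+ 2.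
  by rewrite sqr_sqrtr ?sqseries_ge0// /sqseries seriesSr.
rewrite !S.
apply: le_trans (sqrt_minkowski2 _ _ _ _); rewrite ?sqrtr_ge0 ?rnorm_ge0//.
rewrite ler_sqrt ?addr_ge0 ?sqr_ge0// lerD// lerXn2r// ?nnegrE
  ?addr_ge0 ?sqrtr_ge0 ?rnorm_ge0//.
exact: ler_rnormD.
Qed.

Lemma sqseriesD_le f g n : f \in square_summable -> g \in square_summable ->
  sqseries (f + g) n <= (l2_norm f + l2_norm g) ^+ 2.
Proof.
move=> fs gs.
rewrite -[leLHS]sqr_sqrtr ?sqseries_ge0// lerXn2r// ?nnegrE
  ?addr_ge0 ?sqrtr_ge0//.
apply: (le_trans (sqrt_sqseriesD _ _ _)).
by rewrite lerD// sqrt_sqseries_le.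
Qed.

Lemma sqseriesZ (a : R[i]) f :
  sqseries (a *: f) = complex.Re `|a| ^+ 2 *: (sqseries f : nat -> R^o).
Proof.
apply/funext => n; rewrite /sqseries /series /= [RHS]mulr_sumr.
by apply: eq_bigr => i _; rewrite /= [rnorm _]rnormZ exprMn.
Qed.

Lemma square_summableZ (a : R[i]) f : f \in square_summable ->
  a *: f \in square_summable.
Proof.
move=> /set_mem cf; apply/mem_set => /=.
by rewrite sqseriesZ; exact: is_cvgZr.
Qed.

Lemma square_summableD f g : f \in square_summable -> g \in square_summable ->
  f + g \in square_summable.
Proof.
move=> fs gs; apply/mem_set => /=.
apply: nondecreasing_is_cvgn; first exact: sqseries_nd.
exists ((l2_norm f + l2_norm g) ^+ 2) => _ [n _ <-].
exact: sqseriesD_le.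
Qed.

Lemma square_summable_submod : submod_closed square_summable.
Proof.
split=> [|a f g fs gs]; last by rewrite square_summableD// square_summableZ.
apply/mem_set => /=; rewrite (_ : sqseries 0 = cst 0); first exact: is_cvg_cst.
apply/funext => n; rewrite /sqseries /series /= big1// => i _.
by rewrite [rnorm _]rnorm0 expr0n.
Qed.

HB.instance Definition _ :=
  GRing.isSubmodClosed.Build R[i] (nat -> Y) square_summable
    square_summable_submod.

(* ell_2(Y) *)
Record l2 : Type := L2 { l2_val :> nat -> Y; _ : l2_val \in square_summable }.

HB.instance Definition _ := [isSub for l2_val].
HB.instance Definition _ := [Choice of l2 by <:].
HB.instance Definition _ := [SubChoice_isSubLmodule of l2 by <:].

Let nm (f : l2) : R[i] := (l2_norm f)%:C.

Let nmD (f g : l2) : nm (f + g) <= nm f + nm g.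
Proof.
have [fs gs] := (valP f, valP g).
rewrite -rmorphD lecR.
rewrite -[leRHS]ger0_norm ?addr_ge0 ?sqrtr_ge0// -sqrtr_sqr ler_sqrt ?sqr_ge0//.
apply: limr_le; first exact: set_mem (valP (f + g)).
by apply: nearW => n; exact: sqseriesD_le.
Qed.

Let nmZ (a : R[i]) (f : l2) : nm (a *: f) = `|a| * nm f.
Proof.
rewrite /nm /l2_norm [l2_val _]/(a *: (f : nat -> Y)) sqseriesZ.
rewrite limZr; last exact: set_mem (valP f).
rewrite sqrtrM ?sqr_ge0// normc_def/= sqrtr_sqr ger0_norm ?sqrtr_ge0//.
by rewrite rmorphM.
Qed.

Let nm0 (f : l2) : nm f = 0 -> f = 0.
Proof.
case=> f0; apply/val_inj/funext => n /=; apply/rnorm_eq0/eqP.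
have := sqrt_sqseries_le n.+1 (valP f); rewrite f0.
rewrite -[leRHS]sqrtr0 ler_sqrt// => h.
have : rnorm (f n) ^+ 2 <= 0.
  apply: le_trans h; rewrite /sqseries seriesSr/= lerDr.
  exact: sqseries_ge0.
by rewrite -sqrf_eq0 => h'; rewrite eq_le h' sqr_ge0.
Qed.

HB.instance Definition _ := Lmodule_isNormed.Build R[i] l2 nmD nmZ nm0.

End square_summable.
Arguments l2 {R} Y.

(* Y is Banach; the same property as in completeNormedModType. *)
Definition is_banach (R : realType) (Y : normedModType R[i]) : Prop :=
  forall F : set_system Y, ProperFilter F -> cauchy F -> cvg F.

Definition isometry (R : realType) (E F : normedModType R[i]) (U : E -> F) :
  Prop := forall x, `|U x| = `|x|.

Definition isometrically_isomorphic (R : realType) (E F : normedModType R[i]) :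
  Prop := exists U : {linear E -> F}, isometry U /\ bijective U.

Section contractions.
Context (R : realType) (X : normedModType R[i]).

(* Meaningful for bounded T only: in R, sup is 0 on unbounded sets. *)
Definition opnorm (T : X -> X) : R :=
  sup [set rnorm (T x) | x in [set x | rnorm x <= 1]].

(* A linear map is bounded iff it is continuous. *)
Definition strict_contraction (T : {linear X -> X}) : Prop :=
  continuous T /\ opnorm T < 1.

(* A_T; the radicand is nonnegative when T is a contraction. *)
Definition defect (T : X -> X) (x : X) : R :=
  Num.sqrt (rnorm x ^+ 2 - rnorm (T x) ^+ 2).

End contractions.

Definition op_poly (K : nzRingType) (V : lmodType K) (q : {poly K}) (S : V -> V) :
  V -> V := fun v => \sum_(i < size q) q`_i *: iter i S v.

Section dilation.
Context (R : realType).

Section decomposition.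
Context (E : normedModType R[i]).

(* E = M (+)_2 L, internally *)
Definition is_oplus2 (M L : set E) : Prop :=
  (forall u, exists! wl : E * E, [/\ M wl.1, L wl.2 & u = wl.1 + wl.2]) /\
  (forall w l, M w -> L l -> `|w + l| ^+ 2 = `|w| ^+ 2 + `|l| ^+ 2).

(* The projection w + l |-> w; it is used only when is_oplus2 M L holds,
   so that the w chosen below exists and is unique. *)
Definition proj (M L : set E) (u : E) : E :=
  xget 0 [set w | M w /\ exists2 l, L l & u = w + l].

Definition linear_span (A : set E) : set E :=
  [set u | exists (n : nat) (a : 'I_n -> R[i]) (v : 'I_n -> E),
    (forall i, A (v i)) /\ u = \sum_(i < n) a i *: v i].

End decomposition.

Context (X Xt : completeNormedModType R[i]).

(* W T W^-1 on the range of W (the inverse is 0 outside of the range) *)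
Definition transport (W : X -> Xt) (T : X -> X) (w : Xt) : Xt :=
  W (T (xget 0 [set x | W x = w])).

Definition isometric_dilation (T : {linear X -> X}) (V : {linear Xt -> Xt})
    (W : {linear X -> Xt}) (L : set Xt) : Prop :=
  [/\ isometry V,
      isometry W,
      closed L /\ submod_closed (mem L),
      is_oplus2 (range W) L &
      forall (q : {poly R[i]}) (w : Xt), range W w ->
        op_poly q (transport W T) w = proj (range W) L (op_poly q V w)].

Definition minimal_dilation (V : Xt -> Xt) (W : X -> Xt) : Prop :=
  closure (linear_span [set iter p.1 V (W p.2) | p in [set: nat * X]]) = setT.

End dilation.

Definition dilates_to_isometry (R : realType) (X : completeNormedModType R[i])
    (T : {linear X -> X}) : Prop :=
  exists (Xt : completeNormedModType R[i]) (V : {linear Xt -> Xt})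
    (W : {linear X -> Xt}) (L : set Xt), isometric_dilation T V W L.

(* Main.v *)
(* If V on W(X) (+)_2 L is an isometric dilation of T, put
   D x = V W x - W T x, which lies in L. Pythagoras gives
   |D x|^2 = |x|^2 - |T x|^2 = A_T(x)^2, so A_T is a seminorm, and a norm since
   |T| < 1. The dilation condition for the powers of z puts every V^k D x in L,
   and an induction gives
     |W x + sum_(k < n) V^k D (f k)|^2 = |x|^2 + sum_(k < n) A_T(f k)^2.
   Hence (x, f) |-> W x + sum_k V^k D (f k) is an isometry from
   X (+)_2 ell_2(X_0); its range is closed and contains all V^n W x, so it is
   onto when the dilation is minimal. Conversely, if A_T is a norm, it is
   equivalent to the norm of X, and (x, f) |-> (T x, (x, f_0, f_1, ...)) is a
   minimal isometric dilation of T on X (+)_2 ell_2(X_0). *)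
Require Import Defs.
From HB Require Import structures.
From mathcomp Require Import all_boot all_order all_algebra.
From mathcomp Require Import all_classical all_reals all_analysis.
From mathcomp Require Import complex.
From mathcomp Require Import lra.

Set Implicit Arguments.
Unset Strict Implicit.
Unset Printing Implicit Defensive.

Import Order.TTheory GRing.Theory Num.Theory.
Import numFieldNormedType.Exports.

Local Open Scope classical_set_scope.
Local Open Scope ring_scope.

(** * Norms, sequences and completeness *)

Section normed_sequences.
Context (R : realType) (E : normedModType R[i]).
Implicit Types (x y : E) (u : nat -> E).
Local Open Scope complex_scope.

Lemma rnormN x : rnorm (- x) = rnorm x.
Proof. by rewrite /rnorm normrN. Qed.

Lemma rdistC x y : rnorm (x - y) = rnorm (y - x).
Proof. by rewrite -rnormN opprB. Qed.

Lemma ler_rdistD z x y : rnorm (x - y) <= rnorm (x - z) + rnorm (z - y).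
Proof. by rewrite -[x - y](subrKA z) ler_rnormD. Qed.

Lemma ler_rdist_dist x y : `|rnorm x - rnorm y| <= rnorm (x - y).
Proof.
have h a b : rnorm a - rnorm b <= rnorm (a - b).
  by rewrite lerBlDr -{1}[a](subrK b) ler_rnormD.
by rewrite ler_norml h andbT lerNl opprB rdistC h.
Qed.

Lemma normr_ltE x (e : R) : (`|x| < e%:C) = (rnorm x < e).
Proof. by rewrite rnormE ltcR. Qed.

Lemma gt0_ReK (e : R[i]) : 0 < e -> e = (complex.Re e)%:C /\ 0 < complex.Re e.
Proof. by case: e => a b; rewrite ltcE /= => /andP[/eqP -> ->]. Qed.

Lemma closure_rnormP (A : set E) x :
  closure A x <-> forall e : R, 0 < e -> exists2 y, A y & rnorm (x - y) < e.
Proof.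
split=> [cA e e0|h B].
  have [|y [Ay]] := cA (ball x e%:C); first by apply: nbhsx_ballx; rewrite ltcR.
  by rewrite -ball_normE /= normr_ltE; exists y.
rewrite -nbhs_ballE => -[e /= /gt0_ReK[-> e0] eB].
have [y Ay xy] := h _ e0; exists y; split => //; apply: eB.
by rewrite -ball_normE /= normr_ltE.
Qed.

Lemma cvg_rdistP u x : u @ \oo --> x <->
  forall e : R, 0 < e -> \forall n \near \oo, rnorm (x - u n) < e.
Proof.
split=> [/cvgrPdist_lt h e e0|h].
  have /h : (0 : R[i]) < e%:C by rewrite ltcR.
  by apply: filterS => n; rewrite normr_ltE.
apply/cvgrPdist_lt => e /gt0_ReK[-> /h].
by apply: filterS => n; rewrite normr_ltE.
Qed.

Lemma cvg_rnorm u x : u @ \oo --> x -> (fun n => rnorm (u n)) @ \oo --> rnorm x.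
Proof.
move=> /cvg_rdistP h; apply/cvgrPdist_lt => e /h.
by apply: filterS => n; exact/le_lt_trans/ler_rdist_dist.
Qed.

Definition cauchy_sequence u : Prop := forall e : R, 0 < e ->
  exists N, forall n m, (N <= n)%N -> (N <= m)%N -> rnorm (u n - u m) <= e.

Lemma banach_cauchy_cvgn u : is_banach E -> cauchy_sequence u -> cvgn u.
Proof.
move=> bE cu; apply: bE; apply/cauchyP => e /gt0_ReK[-> e0].
have [|N hN] := cu (complex.Re e / 2); first by rewrite divr_gt0.
exists (u N); exists N => //= n /= Nn; rewrite -ball_normE /= normr_ltE.
apply: le_lt_trans (hN _ _ (leqnn N) Nn) _; lra.
Qed.

(** Choose [u n] so that the ball of radius [1/(n+1)] around it belongs to [F]. Two members of a
    proper filter meet, so [u] is a Cauchy sequence, and its limit is a limit of [F]. *)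
Lemma banachP : (forall u, cauchy_sequence u -> cvgn u) -> is_banach E.
Proof.
move=> hu F FF /cauchyP cF.
have eps_gt0 n : (0 : R) < n.+1%:R^-1 by rewrite invr_gt0 ltr0n.
have /choice[u uF] n : exists x : E, F [set y | rnorm (x - y) < n.+1%:R^-1].
  have [|x Fx] := cF (n.+1%:R^-1)%:C; first by rewrite ltcR.
  exists x; apply: filterS Fx => y; rewrite -ball_normE /= normr_ltE //.
have small (e : R) : 0 < e -> \forall n \near \oo, n.+1%:R^-1 < e.
  move=> e0; have /cvgrPdist_lt/(_ e e0) := @cvg_harmonic R.
  by apply: filterS => n; rewrite /= sub0r normrN ger0_norm ?invr_ge0.
have cu : cauchy_sequence u.
  move=> e e0; have [|N _ hN] := small (e / 2); first by rewrite divr_gt0.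
  exists N => n m Nn Nm.
  have [z [/= zn zm]] := filter_ex (filterI (uF n) (uF m)).
  apply: (le_trans (ler_rdistD z _ _)); rewrite [rnorm (z - _)]rdistC.
  have := lt_trans zn (hN n Nn); have := lt_trans zm (hN m Nm); lra.
have /cvg_ex[l /cvg_rdistP ul] := hu u cu.
apply/cvg_ex; exists l; apply/cvgrPdist_lt => e /gt0_ReK[-> e0].
have e2 : 0 < complex.Re e / 2 by rewrite divr_gt0.
have [n [/= n1 n2]] := filter_ex (filterI (small _ e2) (ul _ e2)).
apply: filterS (uF n) => y /= /lt_trans-/(_ _ n1) n3; rewrite normr_ltE.
have := ler_rdistD (u n) l y; lra.
Qed.

End normed_sequences.

Lemma cvg_contract (R : realType) (E F : normedModType R[i]) (g : E -> F)
    (u : nat -> E) x :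
  (forall y z, rnorm (g y - g z) <= rnorm (y - z)) ->
  u @ \oo --> x -> (fun n => g (u n)) @ \oo --> g x.
Proof.
move=> hg /cvg_rdistP ux; apply/cvg_rdistP => e /ux.
by apply: filterS => n; exact: le_lt_trans.
Qed.

(** Equivalent norms have the same Cauchy sequences and the same limits. *)
Lemma banach_renormed (R : realType) (X : normedModType R[i]) (N : X -> R)
    (hN : is_norm N) (K M : R) :
  (forall x, rnorm x <= K * N x) -> (forall x, N x <= M * rnorm x) ->
  is_banach X -> is_banach (renormed hN).
Proof.
move=> XK XM bX; apply: banachP => u cu.
have [N0 _ _ _] := hN.
(* [K] and [M] may have any sign; their maxima with 1 are positive and can be divided by. *)
have max_gt0 (a : R) : 0 < Num.max a 1 by rewrite lt_max ltr01 orbT.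
have cu' : cauchy_sequence (u : nat -> X).
  move=> e e0; have [|n hn] := cu (e / Num.max K 1); first exact: divr_gt0.
  exists n => p q np nq; apply: le_trans (XK _) _.
  have := hn p q np nq; rewrite ler_pdivlMr // => /(le_trans _); apply.
  by rewrite mulrC ler_wpM2l ?le_max ?lexx // N0.
have /cvg_ex[l /cvg_rdistP ul] := banach_cauchy_cvgn bX cu'.
apply/cvg_ex; exists (l : renormed hN); apply/cvg_rdistP => e e0.
have : 0 < e / Num.max M 1 by exact: divr_gt0.
move=> /ul; apply: filterS => n; rewrite ltr_pdivlMr //; apply: le_lt_trans.
apply: le_trans (XM _) _.
by rewrite mulrC ler_wpM2l ?le_max ?lexx // rnorm_ge0.
Qed.

Section oplus2_theory.
Context (R : realType) (Y1 Y2 : normedModType R[i]).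
Implicit Types u : oplus2 Y1 Y2.

Lemma sqr_rnorm_oplus2 u : rnorm u ^+ 2 = rnorm u.1 ^+ 2 + rnorm u.2 ^+ 2.
Proof. by rewrite sqr_sqrtr // addr_ge0 ?sqr_ge0. Qed.

Lemma rnorm_fst_le u : rnorm u.1 <= rnorm u.
Proof.
rewrite -(@ler_pXn2r _ 2) ?nnegrE ?rnorm_ge0 // sqr_rnorm_oplus2.
by rewrite lerDl sqr_ge0.
Qed.

Lemma rnorm_snd_le u : rnorm u.2 <= rnorm u.
Proof.
rewrite -(@ler_pXn2r _ 2) ?nnegrE ?rnorm_ge0 // sqr_rnorm_oplus2.
by rewrite lerDr sqr_ge0.
Qed.

Lemma rnorm_oplus2_le u : rnorm u <= rnorm u.1 + rnorm u.2.
Proof.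
rewrite -(@ler_pXn2r _ 2) ?nnegrE ?addr_ge0 ?rnorm_ge0 // sqr_rnorm_oplus2.
by rewrite sqrrD addrAC lerDl mulrn_wge0 // mulr_ge0 ?rnorm_ge0.
Qed.

Lemma cvg_oplus2 (u : nat -> oplus2 Y1 Y2) y1 y2 :
  (fun n => (u n).1) @ \oo --> y1 -> (fun n => (u n).2) @ \oo --> y2 ->
  u @ \oo --> ((y1, y2) : oplus2 Y1 Y2).
Proof.
move=> /cvg_rdistP u1 /cvg_rdistP u2; apply/cvg_rdistP => e e0.
have e2 : 0 < e / 2 by rewrite divr_gt0.
apply: filterS2 (u1 _ e2) (u2 _ e2) => n n1 n2.
apply: le_lt_trans (rnorm_oplus2_le _) _ => /=.
by rewrite (splitr e) ltrD.
Qed.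

Lemma banach_oplus2 : is_banach Y1 -> is_banach Y2 -> is_banach (oplus2 Y1 Y2).
Proof.
move=> b1 b2; apply: banachP => u cu.
have /cvg_ex[y1 uy1] : cvgn (fun n => (u n).1).
  apply: banach_cauchy_cvgn => // e /cu[N hN]; exists N => n m Nn Nm.
  exact: le_trans (rnorm_fst_le (u n - u m)) (hN n m Nn Nm).
have /cvg_ex[y2 uy2] : cvgn (fun n => (u n).2).
  apply: banach_cauchy_cvgn => // e /cu[N hN]; exists N => n m Nn Nm.
  exact: le_trans (rnorm_snd_le (u n - u m)) (hN n m Nn Nm).
by apply/cvg_ex; exists (y1, y2); exact: cvg_oplus2.
Qed.

End oplus2_theory.

Section l2_theory.
Context (R : realType) (Y : normedModType R[i]).

Lemma sqr_rnorm_l2 (f : l2 Y) : rnorm f ^+ 2 = limn (sqseries f).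
Proof. by rewrite sqr_sqrtr // sqseries_lim_ge0 // (valP f). Qed.

Lemma cvg_sqseries (f : l2 Y) : sqseries f @ \oo --> rnorm f ^+ 2.
Proof. by rewrite sqr_rnorm_l2; exact: set_mem (valP f). Qed.

Lemma sqseries_le (f : l2 Y) n : sqseries f n <= rnorm f ^+ 2.
Proof.
rewrite sqr_rnorm_l2; apply: nondecreasing_cvgn_le; first exact: sqseries_nd.
exact: set_mem (valP f).
Qed.

Lemma sqseriesS (f : nat -> Y) n :
  sqseries f n.+1 = sqseries f n + rnorm (f n) ^+ 2.
Proof. by rewrite /sqseries seriesSr. Qed.

Lemma rnorm_coord_le (f : l2 Y) n : rnorm (f n) <= rnorm f.
Proof.
rewrite -(@ler_pXn2r _ 2) ?nnegrE ?rnorm_ge0 //.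
apply: le_trans (sqseries_le f n.+1).
by rewrite sqseriesS lerDr sqseries_ge0.
Qed.

Lemma square_summable_bounded (f : nat -> Y) (e : R) :
  (forall n, sqseries f n <= e) -> f \in @square_summable R Y.
Proof.
move=> fe; apply/mem_set/nondecreasing_is_cvgn; first exact: sqseries_nd.
by exists e => _ [n _ <-].
Qed.

Lemma rnorm_l2_le (f : l2 Y) (e : R) : 0 <= e ->
  (forall n, sqseries f n <= e ^+ 2) -> rnorm f <= e.
Proof.
move=> e0 fe; rewrite -(@ler_pXn2r _ 2) ?nnegrE ?rnorm_ge0 // sqr_rnorm_l2.
by apply: limr_le; [exact: set_mem (valP f)|exact: nearW].
Qed.

Lemma cvg_sqseries_pointwise (u : nat -> nat -> Y) (g : nat -> Y) k :
  (forall i, (fun n => u n i) @ \oo --> g i) ->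
  (fun n => sqseries (u n) k) @ \oo --> sqseries g k.
Proof.
move=> ug; elim: k => [|k IH].
  rewrite [X in _ --> X]big_geq // (_ : (fun _ => _) = cst 0).
    exact: cvg_cst.
  by apply/funext => n; rewrite [LHS]big_geq.
rewrite sqseriesS; under eq_fun do rewrite sqseriesS.
by apply: cvgD => //; rewrite expr2; under eq_fun do rewrite expr2;
  apply: cvgM; exact: cvg_rnorm.
Qed.

(** Coordinatewise limits give a candidate [g]; bounds on partial sums, uniform in their length, put
    [g] in [l2 Y] and make it the limit in norm. *)
Lemma banach_l2 : is_banach Y -> is_banach (l2 Y).
Proof.
move=> bY; apply: banachP => u cu.
have /choice[g ug] (k : nat) : exists y : Y, (fun n => u n k) @ \oo --> y.
  apply/cvg_ex/banach_cauchy_cvgn => // e /cu[N hN]; exists N => n m Nn Nm.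
  exact: le_trans (rnorm_coord_le (u n - u m) k) (hN n m Nn Nm).
(* For fixed [k], the bound on the partial sums of [u m - u n] passes to the limit in [m]. It is
   stated on partial sums because [g] is not yet known to be square-summable. *)
have ug_le (e : R) : 0 < e -> exists N, forall n, (N <= n)%N ->
    forall k, sqseries (g - u n) k <= e ^+ 2.
  move=> e0; have [N hN] := cu _ e0; exists N => n Nn k.
  have ugk : (fun m => sqseries (u m - u n : l2 Y) k) @ \oo -->
      sqseries (g - u n) k.
    apply: cvg_sqseries_pointwise => i; apply: cvgB; first exact: ug.
    exact: cvg_cst.
  rewrite -(cvg_lim _ ugk) //; apply: limr_le.
    by apply/cvg_ex; exists (sqseries (g - u n) k).
  exists N => // m /= Nm; apply: le_trans (sqseries_le (u m - u n) k) _.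
  by rewrite lerXn2r ?nnegrE ?rnorm_ge0 ?hN // ltW.
have gs : g \in @square_summable R Y.
  have [N /(_ N (leqnn N)) hN] := ug_le 1 ltr01.
  rewrite -(subrK (u N : nat -> Y) g) square_summableD //.
    exact: square_summable_bounded hN.
  exact: valP.
apply/cvg_ex; exists (L2 gs); apply/cvg_rdistP => e e0.
have [|N hN] := ug_le (e / 2); first by rewrite divr_gt0.
exists N => // n /= Nn; apply: (@le_lt_trans _ _ (e / 2)); last lra.
by apply: rnorm_l2_le => [|k]; [lra|exact: hN].
Qed.

(** Coordinates are contractions on [l2 Y], so they converge along with [v] and determine its
    limit. *)
Lemma cvg_l2_eq (v : nat -> l2 Y) (f g : l2 Y) :
  v @ \oo --> g -> (forall k, \forall n \near \oo, v n k = f k) -> g = f.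
Proof.
move=> vg vf; apply/val_inj/funext => k.
have gk : (fun n => v n k) @ \oo --> g k.
  apply: (cvg_contract (g := fun h : l2 Y => h k)) vg => h h'.
  exact: rnorm_coord_le (h - h') k.
by apply: (norm_cvg_unique gk); exact: cvg_near_cst.
Qed.

End l2_theory.

(** * Linear isometries and spans *)

Section linear_maps.
Context (R : realType).
Local Open Scope complex_scope.

(** The existential hides the bundled map: once it is destructed, only [g =1 f] remains. *)
Lemma exists_linear (E F : lmodType R[i]) (f : E -> F) :
  linear f -> exists g : {linear E -> F}, g =1 f.
Proof.
move=> lf.
pose m := GRing.isLinear.Build R[i] E F *:%R f lf.
pose g : {linear E -> F} := HB.pack f m.
by exists g.
Qed.

Lemma iter_linear (E : lmodType R[i]) (V : {linear E -> E}) n :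
  linear (iter n V).
Proof. by elim: n => // n IH a x y; rewrite !iterS IH linearP. Qed.

Lemma iter_linearB (E : lmodType R[i]) (V : {linear E -> E}) n x y :
  iter n V (x - y) = iter n V x - iter n V y.
Proof. by elim: n => // n IH; rewrite !iterS IH linearB. Qed.

Lemma rnorm_isometry (E F : normedModType R[i]) (U : E -> F) x :
  Defs.isometry U -> rnorm (U x) = rnorm x.
Proof. by move=> iU; rewrite /rnorm iU. Qed.

Lemma isometryP (E F : normedModType R[i]) (U : E -> F) :
  (forall x, rnorm (U x) ^+ 2 = rnorm x ^+ 2) -> Defs.isometry U.
Proof.
move=> h x; rewrite !rnormE; congr (_%:C).
by apply/eqP; rewrite -(@eqrXn2 _ 2) ?rnorm_ge0 ?h.
Qed.

Lemma isometry_inj (E F : normedModType R[i]) (U : {linear E -> F}) :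
  Defs.isometry U -> injective U.
Proof.
move=> iU x y Uxy; apply/subr0_eq/normr0_eq0.
by rewrite -iU linearB Uxy subrr normr0.
Qed.

Lemma isometric_isomorphism_inv (E F : normedModType R[i])
    (U : {linear E -> F}) :
  Defs.isometry U -> (forall y, exists x, U x = y) ->
  isometrically_isomorphic F E.
Proof.
move=> iU /choice[g gK].
have Kg : cancel U g by move=> x; apply: (isometry_inj iU); rewrite gK.
have [h hE] : exists h : {linear F -> E}, h =1 g.
  apply: exists_linear => a x y.
  by apply: (isometry_inj iU); rewrite linearP !gK.
exists h; split; first by move=> y; rewrite hE -iU gK.
by exists U => x; rewrite hE ?gK ?Kg.
Qed.

(** The range of an isometry on a Banach space is closed: if the [U (u n)] tend to [y], then [u] is
    Cauchy because [U] preserves distances, and its limit is sent to [y]. *)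
Lemma isometry_dense_range (E F : normedModType R[i]) (U : {linear E -> F}) :
  is_banach E -> Defs.isometry U -> closure (range U) = setT ->
  forall y, exists x, U x = y.
Proof.
move=> bE iU dU y.
have /choice[u uE] (n : nat) : exists x : E, rnorm (y - U x) < n.+1%:R^-1.
  have /closure_rnormP/(_ n.+1%:R^-1)[] : closure (range U) y by rewrite dU.
    by rewrite invr_gt0.
  by move=> _ [x _ <-] ?; exists x.
have Uu : (fun n => U (u n)) @ \oo --> y.
  apply/cvg_rdistP => e e0.
  have /cvgrPdist_lt/(_ e e0) := @cvg_harmonic R.
  apply: filterS => n /=; rewrite sub0r normrN ger0_norm ?invr_ge0 //.
  exact: (lt_trans (uE n)).
have cu : cauchy_sequence u.
  move=> e e0; have e2 : 0 < e / 2 by rewrite divr_gt0.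
  have /cvg_rdistP/(_ _ e2)[N _ hN] := Uu.
  exists N => n m /hN /= n1 /hN /= n2.
  rewrite -(rnorm_isometry _ iU) linearB.
  have := ler_rdistD y (U (u n)) (U (u m)).
  by rewrite [rnorm (_ - y)]rdistC; lra.
have /cvg_ex[x /cvg_rdistP ux] := banach_cauchy_cvgn bE cu.
exists x; apply/esym; apply: (norm_cvg_unique Uu).
apply/cvg_rdistP => e /ux; apply: filterS => n.
by rewrite -(rnorm_isometry _ iU) linearB.
Qed.

(** The constant is [opnorm T] itself. Continuity at 0 comes first, since the set whose supremum
    defines [opnorm] must be bounded for the supremum to dominate its elements. *)
Lemma strict_contraction_bound (X : normedModType R[i]) (T : {linear X -> X}) :
  strict_contraction T ->
  exists2 c : R, 0 <= c < 1 & forall x, rnorm (T x) <= c * rnorm x.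
Proof.
move=> [cT T1].
have rnorm_real (a : R) (x : X) : 0 <= a -> rnorm (a%:C *: x) = a * rnorm x.
  by move=> a0; rewrite rnormZ normc_def /= expr0n addr0 sqrtr_sqr ger0_norm.
have [d d0 hd] : exists2 d : R, 0 < d &
    forall y, rnorm y < d -> rnorm (T y) < 1.
  have /cvgrPdist_lt/(_ 1 ltr01) := cT 0.
  rewrite linear0 -nbhs_ballE => -[d /= /gt0_ReK[-> d0] hd].
  exists (complex.Re d) => // y yd; rewrite -normr_ltE -normrN -sub0r.
  by apply: hd; rewrite -ball_normE /= sub0r normrN normr_ltE.
pose S := [set rnorm (T x) | x in [set x : X | rnorm x <= 1]].
(* If [rnorm x <= 1], then [x] scaled by [d / 2] has norm below [d]. *)
have ubS : ubound S (2 / d).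
  move=> _ [x /= x1 <-].
  have := hd ((d / 2)%:C *: x); rewrite linearZ /= !rnorm_real; try lra.
  rewrite ler_pdivlMr // => h.
  have : d / 2 * rnorm x < d.
    by apply: (@le_lt_trans _ _ (d / 2 * 1)); [rewrite ler_pM2l //; lra|lra].
  by move=> /h; lra.
have hS : has_sup S.
  split; last by exists (2 / d).
  by exists (rnorm (T 0)), 0 => //=; rewrite rnorm0.
exists (opnorm T).
  rewrite T1 andbT; apply: ub_le_sup; first exact: hS.2.
  by exists 0; rewrite /= ?linear0 rnorm0.
move=> x; have [->|x0] := eqVneq x 0; first by rewrite linear0 rnorm0 mulr0.
have r0 : 0 < rnorm x.
  rewrite lt_neqAle rnorm_ge0 andbT eq_sym.
  by apply: contra_neq x0 => /rnorm_eq0.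
have r1 : 0 <= (rnorm x)^-1 by rewrite invr_ge0 ltW.
rewrite -ler_pdivrMr // mulrC -rnorm_real // -linearZ.
apply: ub_le_sup; first exact: hS.2.
exists ((rnorm x)^-1%:C *: x) => //=.
by rewrite rnorm_real // mulVf ?gt_eqF.
Qed.

End linear_maps.

Section spans.
Context (R : realType) (E : normedModType R[i]).
Implicit Types (A M L : set E) (u v : E).

Lemma linear_span_sub A u : A u -> linear_span A u.
Proof.
move=> Au; exists 1%N, (fun=> 1), (fun=> u); split=> //.
by rewrite big_ord1 scale1r.
Qed.

Lemma linear_spanD A u v :
  linear_span A u -> linear_span A v -> linear_span A (u + v).
Proof.
move=> [n [a [x [Ax ->]]]] [m [b [y [Ay ->]]]].
exists (n + m)%N,
  (fun i => match fintype.split i with inl j => a j | inr j => b j end),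
  (fun i => match fintype.split i with inl j => x j | inr j => y j end); split.
  by move=> i; case: (fintype.split i).
rewrite big_split_ord /=; congr (_ + _); apply: eq_bigr => i _.
  by rewrite (unsplitK (inl i : 'I_n + 'I_m)).
by rewrite (unsplitK (inr i : 'I_n + 'I_m)).
Qed.

Lemma linear_spanN A u : linear_span A u -> linear_span A (- u).
Proof.
move=> [n [a [x [Ax ->]]]]; exists n, (fun i => - a i), x; split=> //.
by rewrite -sumrN; apply: eq_bigr => i _; rewrite scaleNr.
Qed.

Lemma linear_span_range (F : lmodType R[i]) (U : {linear F -> E}) A :
  A `<=` range U -> linear_span A `<=` range U.
Proof.
move=> AU _ [n [a [v [Av ->]]]].
have /choice[p pE] i : exists y, U y = v i.
  by have [y _ <-] := AU _ (Av i); exists y.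
exists (\sum_(i < n) a i *: p i) => //.
by rewrite linear_sum; apply: eq_bigr => i _; rewrite linearZ /= pE.
Qed.

(** Uniqueness of the decomposition forces the choice made by [xget]. *)
Lemma proj_add M L w l :
  is_oplus2 M L -> M w -> L l -> Defs.proj M L (w + l) = w.
Proof.
move=> [dec _] Mw Ll; have [[w' l'] [_ uni]] := dec (w + l).
apply: xget_unique => [|v [Mv [k Lk vk]]]; first by split=> //; exists l.
have := uni (v, k) (And3 Mv Lk vk).
by have -> := uni (w, l) (And3 Mw Ll erefl); case.
Qed.

Lemma proj_dec M L u :
  is_oplus2 M L -> M (Defs.proj M L u) /\ L (u - Defs.proj M L u).
Proof.
move=> hML; have [[w l] [[Mw Ll ->] _]] := hML.1 u.
by rewrite (proj_add hML) // addrAC subrr add0r.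
Qed.

End spans.

(** Monomials turn the polynomial condition of a dilation into a condition on powers. *)
Lemma op_polyXn (K : nzRingType) (V : lmodType K) n (S : V -> V) v :
  op_poly 'X^n S v = iter n S v.
Proof.
rewrite /op_poly size_polyXn big_ord_recr /= coefXn eqxx scale1r big1 ?add0r //.
by move=> i _; rewrite coefXn ltn_eqF // scale0r.
Qed.

Lemma iter_transport (R : realType) (X Xt : completeNormedModType R[i])
    (W : X -> Xt) (T : X -> X) n x : injective W ->
  iter n (transport W T) (W x) = W (iter n T x).
Proof.
move=> iW; elim: n => //= n ->; congr (W (T _)).
by apply: xget_unique => // y /iW.
Qed.

(** * The structure of an isometric dilation *)

Section dilation_structure.
Context (R : realType) (X Xt : completeNormedModType R[i]).
Context (T : {linear X -> X}) (V : {linear Xt -> Xt}) (W : {linear X -> Xt}).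
Context (L : set Xt) (hD : isometric_dilation T V W L).
Local Open Scope complex_scope.

Let iV : Defs.isometry V. Proof. by case: hD. Qed.
Let iW : Defs.isometry W. Proof. by case: hD. Qed.
Let hML : is_oplus2 (range W) L. Proof. by case: hD. Qed.

Let Llin a u v : L u -> L v -> L (a *: u + v).
Proof.
case: hD => _ _ [_ [_ hL]] _ _ Lu Lv.
by have := hL a u v; rewrite !inE; apply.
Qed.

Let L0 : L 0.
Proof. by case: hD => _ _ [_ [hL _]] _ _; move: hL; rewrite inE. Qed.

Let LD u v : L u -> L v -> L (u + v).
Proof. by move=> Lu Lv; rewrite -[u]scale1r; exact: Llin. Qed.

Let LB u v : L u -> L v -> L (u - v).
Proof. by move=> Lu Lv; rewrite addrC -scaleN1r; exact: Llin. Qed.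

(** The map [D] of the overview. For Hilbert spaces the closure of its range is the wandering
    subspace of the minimal isometric dilation. *)
Definition wandering x : Xt := V (W x) - W (T x).

Lemma wandering_linear : linear wandering.
Proof.
move=> a x y; rewrite /wandering !linearP scalerDr.
by rewrite addrACA.
Qed.

(** By the dilation condition for ['X^n], the projection of [V^n W x] is [W T^n x]; the difference
    is the component in [L]. *)
Let LV n x : L (iter n V (W x) - W (iter n T x)).
Proof.
have WR y : range W (W y) by exists y.
case: hD => _ _ _ _ /(_ 'X^n _ (WR x)).
rewrite !op_polyXn iter_transport; last exact: isometry_inj.
by move=> ->; have [] := proj_dec (iter n V (W x)) hML.
Qed.

(** [V^n D x] is a difference of two vectors given by [LV], one for [x] with exponent [n + 1], one
    for [T x] with exponent [n]; their terms [W T^(n+1) x] cancel. *)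
Lemma iter_wandering_in n x : L (iter n V (wandering x)).
Proof.
have -> : iter n V (wandering x) =
    (iter n.+1 V (W x) - W (iter n.+1 T x)) -
    (iter n V (W (T x)) - W (iter n T (T x))).
  by rewrite -iterSr opprB addrA subrK iterSr iter_linearB.
exact: LB.
Qed.

Lemma pythagoras x l :
  L l -> rnorm (W x + l) ^+ 2 = rnorm x ^+ 2 + rnorm l ^+ 2.
Proof.
move=> Ll; have := hML.2 _ _ (imageT W x) Ll.
by rewrite iW !rnormE -!rmorphXn -rmorphD => -[].
Qed.

(** Pythagoras for [V W x = W T x + D x], where the left side has the norm of [x]. *)
Lemma sqr_rnorm_wandering x :
  rnorm (wandering x) ^+ 2 = rnorm x ^+ 2 - rnorm (T x) ^+ 2.
Proof.
have := pythagoras (T x) (iter_wandering_in 0 x).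
rewrite /= /wandering addrC subrK !rnorm_isometry // => ->.
by rewrite addrAC subrr add0r.
Qed.

Lemma rnorm_wandering x : rnorm (wandering x) = defect T x.
Proof.
by rewrite /defect -sqr_rnorm_wandering sqrtr_sqr ger0_norm ?rnorm_ge0.
Qed.

Definition wandering_sum (f : nat -> X) n : Xt :=
  \sum_(k < n) iter k V (wandering (f k)).

Lemma wandering_sumS f n : wandering_sum f n.+1 =
  wandering_sum f n + iter n V (wandering (f n)).
Proof. exact: big_ord_recr. Qed.

Lemma iter_wandering0 n : iter n V (wandering 0) = 0.
Proof.
have [g gE] := exists_linear wandering_linear.
have [h hE] := exists_linear (iter_linear V n).
by rewrite -hE -gE !linear0.
Qed.

Lemma wandering_sum0 f n : (forall k, (k < n)%N -> f k = 0) ->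
  wandering_sum f n = 0.
Proof.
by move=> f0; apply: big1 => k _; rewrite f0 // iter_wandering0.
Qed.

Lemma wandering_sum_in f n : L (wandering_sum f n).
Proof.
elim: n => [|n IH]; first by rewrite /wandering_sum big_ord0.
by rewrite wandering_sumS; apply: LD => //; exact: iter_wandering_in.
Qed.

(** Taking out the first term instead of the last lets [V] factor out of the rest, which suits an
    induction that uses the isometry of [V]. *)
Lemma wandering_sumSl f n : wandering_sum f n.+1 =
  wandering (f 0) + V (wandering_sum (fun k => f k.+1) n).
Proof. by rewrite [LHS]big_ord_recl linear_sum. Qed.

(* With s = wandering_sum (fun k => f k.+1) n, the vector W (f 0) + s is sent
   by V to W (T (f 0)) + wandering_sum f n.+1; compare the two norms. *)
Lemma sqr_rnorm_wandering_sum f n :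
  rnorm (wandering_sum f n) ^+ 2 = \sum_(k < n) defect T (f k) ^+ 2.
Proof.
elim: n f => [|n IH] f.
  by rewrite /wandering_sum !big_ord0 rnorm0 expr0n.
set s := wandering_sum (fun k => f k.+1) n.
have VE : V (W (f 0) + s) = W (T (f 0)) + wandering_sum f n.+1.
  by rewrite wandering_sumSl linearD /wandering -/s addrA addrCA subrr addr0.
have := pythagoras (f 0) (wandering_sum_in (fun k => f k.+1) n).
rewrite -/s -(rnorm_isometry _ iV) VE pythagoras; last exact: wandering_sum_in.
rewrite IH big_ord_recl -rnorm_wandering sqr_rnorm_wandering /= => h.
by rewrite addrAC -h addrAC subrr add0r.
Qed.

Lemma wandering_sum_linear n : linear (wandering_sum^~ n).
Proof.
move=> a f g; rewrite /wandering_sum scaler_sumr -big_split /=.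
by apply: eq_bigr => k _; rewrite wandering_linear iter_linear.
Qed.

Lemma defect_is_norm (c : R) : 0 <= c < 1 ->
  (forall x, rnorm (T x) <= c * rnorm x) -> is_norm (defect T).
Proof.
move=> /andP[c0 c1] Tc; have [g gE] := exists_linear wandering_linear.
have DE x : defect T x = rnorm (g x) by rewrite gE rnorm_wandering.
split=> [x|x|a x|x y]; rewrite ?DE.
- exact: rnorm_ge0.
(* A zero of the defect satisfies [|T x| = |x|], and [|T x| <= c |x|] with [c < 1] then forces
   [x = 0]. *)
- move=> gx0; have := sqr_rnorm_wandering x; rewrite -gE gx0 expr0n /= => /esym.
  move=> /eqP; rewrite subr_eq0 eqrXn2 ?rnorm_ge0 // => /eqP xT.
  have := Tc x; have := rnorm_ge0 x; rewrite -xT => x0 xc; apply: rnorm_eq0.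
  nra.
- by rewrite linearZ rnormZ.
- by rewrite linearD ler_rnormD.
Qed.

(** * The isometry from the direct sum into the dilation space *)

Section limit_map.
Context (hA : is_norm (defect T)).
Local Notation X0 := (renormed hA).

Lemma sqseries_defect (f : nat -> X0) n :
  sqseries f n = \sum_(k < n) defect T (f k) ^+ 2.
Proof. by rewrite /sqseries /series /= big_mkord. Qed.

Lemma sqr_rnorm_wandering_sumB (f : nat -> X0) m n : (m <= n)%N ->
  rnorm (wandering_sum f n - wandering_sum f m) ^+ 2 =
  sqseries f n - sqseries f m.
Proof.
move=> /subnK <-; move: (n - m)%N => p {n}.
(* The difference of the partial sums is itself a partial sum, for [f] set to zero below [m], so
   [sqr_rnorm_wandering_sum] applies to it. *)
pose g k := if (k < m)%N then 0 else f k : X.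
have -> : wandering_sum f (p + m) - wandering_sum f m = wandering_sum g (p + m).
  elim: p => [|p IH].
    by rewrite subrr wandering_sum0 // => k km; rewrite /g km.
  by rewrite addSn !wandering_sumS addrAC IH /g ltnNge leq_addl.
rewrite sqr_rnorm_wandering_sum !sqseries_defect.
elim: p => [|p IH].
  rewrite subrr big1 // => k _; rewrite /g ltn_ord.
  have [_ _ h _] := hA; have := h 0 0; rewrite scale0r normr0 mul0r => ->.
  by rewrite expr0n.
by rewrite addSn !big_ord_recr /= IH addrAC /g ltnNge leq_addl.
Qed.

(** Squared distances between partial sums are differences of [sqseries f], which converges. *)
Lemma cvg_wandering_sum (f : l2 X0) : cvgn (wandering_sum f).
Proof.
apply: banach_cauchy_cvgn; first by move=> F FF cF; exact: cauchy_cvg.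
move=> e e0.
(* As [rnorm f ^+ 2] is both the limit and an upper bound of [sqseries f], any two terms beyond [N]
   differ by at most [e ^+ 2]. *)
have [N _ hN] : \forall n \near \oo, rnorm f ^+ 2 - e ^+ 2 <= sqseries f n.
  have /cvgrPdist_lt/(_ (e ^+ 2)) := @cvg_sqseries _ _ f.
  rewrite exprn_gt0 // => /(_ isT); apply: filterS => n.
  by move=> /(le_lt_trans (ler_norm _)) ?; lra.
have {}hN n m : (N <= m)%N -> (m <= n)%N ->
    rnorm (wandering_sum f n - wandering_sum f m) <= e.
  move=> Nm mn; rewrite -(@ler_pXn2r _ 2) ?nnegrE ?rnorm_ge0 ?(ltW e0) //.
  rewrite sqr_rnorm_wandering_sumB //.
  by have := hN m Nm; have := sqseries_le f n; move=> /=; lra.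
exists N => n m Nn Nm; have [mn|/ltnW nm] := leqP m n; first exact: hN.
by rewrite rdistC; exact: hN.
Qed.

(** The partial sums are linear in [(x, f)] and have explicit norms; linearity and the norm identity
    survive in the limit. Minimality is not assumed, so the model below can use this map too. *)
Lemma limit_map_exists : exists U : {linear oplus2 X (l2 X0) -> Xt},
  Defs.isometry U /\
  forall x (f : l2 X0),
    (fun n => W x + wandering_sum f n) @ \oo --> U ((x, f) : oplus2 X (l2 X0)).
Proof.
pose u (p : oplus2 X (l2 X0)) : Xt := W p.1 + limn (wandering_sum p.2).
have uP (p : oplus2 X (l2 X0)) :
    (fun n => W p.1 + wandering_sum p.2 n) @ \oo --> u p.
  by apply: cvgD; [exact: cvg_cst|exact: cvg_wandering_sum].
have [U UE] : exists U : {linear oplus2 X (l2 X0) -> Xt}, U =1 u.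
  apply: exists_linear => a p q.
  apply: (norm_cvg_unique (uP (a *: p + q))).
  have -> : (fun n => W (a *: p + q).1 + wandering_sum (a *: p + q).2 n) =
      (fun n => a *: (W p.1 + wandering_sum p.2 n) +
                (W q.1 + wandering_sum q.2 n)).
    apply/funext => n; have /= -> := wandering_sum_linear n a p.2 q.2.
    by rewrite linearP scalerDr addrACA.
  by apply: cvgD => //; apply: cvgZr.
exists U; split; last by move=> x f; rewrite UE; exact: uP.
apply: isometryP => p; rewrite UE sqr_rnorm_oplus2.
have /cvg_rnorm up := uP p.
have up2 : (fun n => rnorm (W p.1 + wandering_sum p.2 n) ^+ 2) @ \oo -->
    rnorm (u p) ^+ 2.
  by rewrite expr2; under eq_fun do rewrite expr2; exact: cvgM.
apply: (norm_cvg_unique up2) => /=.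
under eq_fun do rewrite (pythagoras _ (wandering_sum_in _ _))
  sqr_rnorm_wandering_sum -(sqseries_defect p.2).
by apply: cvgD; [exact: cvg_cst|exact: cvg_sqseries].
Qed.

End limit_map.

End dilation_structure.

(** * Shifts and minimal dilations *)

Section l2_shift.
Context (R : realType) (Y : normedModType R[i]).

Definition seq_cons (y : Y) (f : nat -> Y) n := if n is k.+1 then f k else y.

Lemma sqseries_consS y (f : nat -> Y) n :
  sqseries (seq_cons y f) n.+1 = rnorm y ^+ 2 + sqseries f n.
Proof.
elim: n => [|n IH]; last by rewrite sqseriesS IH sqseriesS addrA.
by rewrite sqseriesS /sqseries /series /= !big_geq // addrC.
Qed.

Lemma seq_cons_summable y (f : l2 Y) : seq_cons y f \in @square_summable R Y.
Proof.
apply: (@square_summable_bounded _ _ _ (rnorm y ^+ 2 + rnorm f ^+ 2)) => n.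
(* Monotonicity passes from [n] to [n.+1], where [sqseries_consS] applies. *)
apply: le_trans (sqseries_nd _ (leqnSn n)) _.
by rewrite sqseries_consS lerD2l sqseries_le.
Qed.

Definition l2_cons y f : l2 Y := L2 (seq_cons_summable y f).

Lemma sqr_rnorm_l2_cons y f :
  rnorm (l2_cons y f) ^+ 2 = rnorm y ^+ 2 + rnorm f ^+ 2.
Proof.
have := @cvg_sqseries _ _ (l2_cons y f); rewrite -cvg_shiftS => h.
apply: (norm_cvg_unique h) => /=; under eq_fun do rewrite sqseries_consS.
by apply: cvgD; [exact: cvg_cst|exact: cvg_sqseries].
Qed.

Lemma l2_cons_linear a (y z : Y) (f g : l2 Y) :
  l2_cons (a *: y + z) (a *: f + g) = a *: l2_cons y f + l2_cons z g.
Proof. by apply/val_inj/funext => -[|k]. Qed.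

(** The sequence supported at index [n]; building it from [l2_cons] makes square summability
    automatic. *)
Definition l2_single n (y : Y) : l2 Y := iter n (l2_cons 0) (l2_cons y 0).

Lemma l2_singleE n y k : l2_single n y k = if k == n then y else 0.
Proof. by elim: n k => [|n IH] [|k] //=; rewrite -IH. Qed.

End l2_shift.

Section minimality.
Context (R : realType) (X Xt : completeNormedModType R[i]).
Context (T : {linear X -> X}) (V : {linear Xt -> Xt}) (W : {linear X -> Xt}).
Context (L : set Xt) (hD : isometric_dilation T V W L).
Context (hA : is_norm (defect T)).
Local Notation X0 := (renormed hA).

(** The range of [U] contains every [W x] and [V^n D x], hence the orbits that span a dense
    subspace; [isometry_dense_range] then makes [U] onto. *)
Lemma minimal_dilation_isomorphic :
  is_banach X0 -> minimal_dilation V W ->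
  isometrically_isomorphic Xt (oplus2 X (l2 X0)).
Proof.
move=> bX0 minV; have [U [iU Ulim]] := limit_map_exists hD hA.
apply: (isometric_isomorphism_inv iU); apply: isometry_dense_range => //.
  by apply: banach_oplus2; [move=> F FF cF; exact: cauchy_cvg|exact: banach_l2].
have UW x : U ((x, 0) : oplus2 X (l2 X0)) = W x.
  apply: norm_cvg_unique (Ulim x 0) _ => /=.
  under eq_fun do rewrite wandering_sum0 // addr0.
  exact: cvg_cst.
have UD n x : U ((0, l2_single n (x : X0)) : oplus2 X (l2 X0)) =
    iter n V (wandering T V W x).
  apply: norm_cvg_unique (Ulim 0 _) _ => /=.
  (* The partial sums are constant from [n.+1] on, the first one that includes index [n]. *)
  apply: cvg_near_cst; exists n.+1 => // m /= nm.
  rewrite linear0 add0r -(subnK nm); elim: (m - n.+1)%N => [|p IH].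
    rewrite add0n wandering_sumS wandering_sum0 ?add0r ?l2_singleE ?eqxx //.
    by move=> k kn; rewrite l2_singleE ltn_eqF.
  rewrite addSn wandering_sumS IH l2_singleE gtn_eqF ?leq_addl //.
  by rewrite -[RHS]addr0; congr (_ + _); exact: iter_wandering0.
have spanU : linear_span [set iter p.1 V (W p.2) | p in [set: nat * X]]
    `<=` range U.
  apply: linear_span_range => _ [[n x] _ <-] /=.
  (* Induction for all [x] at once, by [V^(n+1) W x = V^n D x + V^n W (T x)]. *)
  elim: n x => [|n IH] x; first by exists (x, 0).
  have [p _ pE] := IH (T x).
  exists ((0, l2_single n (x : X0)) + p) => //.
  by rewrite linearD pE UD /wandering iter_linearB -iterSr subrK.
by apply/seteqP; split=> // y _; apply: (closure_subset spanU); rewrite minV.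
Qed.

(** Each term splits as [V^k D y = V^(k+1) W y - V^k W (T y)]. This yields the minimality of the
    model. *)
Lemma wandering_sum_in_span x (f : nat -> X) n :
  linear_span [set iter p.1 V (W p.2) | p in [set: nat * X]]
    (W x + wandering_sum T V W f n).
Proof.
have orbit k y : linear_span [set iter p.1 V (W p.2) | p in [set: nat * X]]
    (iter k V (W y)).
  by apply: linear_span_sub; exists (k, y).
elim: n => [|n IH].
  by rewrite /wandering_sum big_ord0 addr0; exact: (orbit 0%N).
rewrite wandering_sumS addrA; apply: linear_spanD => //.
rewrite /wandering iter_linearB -iterSr.
apply: linear_spanD; first exact: orbit.
exact/linear_spanN/orbit.
Qed.

End minimality.

(* Xt stands for X (+)_2 ell_2(X_0); it is given abstractly by its coordinates
   p1 and p2 because conversion blows up on the concrete space. *)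
Section model_dilation.
Context (R : realType) (X Xt : completeNormedModType R[i]).
Context (T : {linear X -> X}) (Tle : forall x, rnorm (T x) <= rnorm x).
Context (hA : is_norm (defect T)).
Local Notation X0 := (renormed hA).
Context (p1 : {linear Xt -> X}) (p2 : {linear Xt -> l2 X0}).
Context (mk : X -> l2 X0 -> Xt).
Context (p1mk : forall x f, p1 (mk x f) = x).
Context (p2mk : forall x f, p2 (mk x f) = f).
Context (mkp : forall u, mk (p1 u) (p2 u) = u).
Context (sqr_rnormE : forall u,
  rnorm u ^+ 2 = rnorm (p1 u) ^+ 2 + rnorm (p2 u) ^+ 2).
Local Open Scope complex_scope.

Let mk_eq u v : p1 u = p1 v -> p2 u = p2 v -> u = v.
Proof. by move=> h1 h2; rewrite -(mkp u) h1 h2 mkp. Qed.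

Let rnorm_p1_le u : rnorm (p1 u) <= rnorm u.
Proof.
rewrite -(@ler_pXn2r _ 2) ?nnegrE ?rnorm_ge0 // sqr_rnormE.
by rewrite lerDl sqr_ge0.
Qed.

Let rnorm_p2_le u : rnorm (p2 u) <= rnorm u.
Proof.
rewrite -(@ler_pXn2r _ 2) ?nnegrE ?rnorm_ge0 // sqr_rnormE.
by rewrite lerDr sqr_ge0.
Qed.

(** Here [W x = (x, 0)], [L] is the kernel of [p1], and [V] is isometric because
    [|T x|^2 + A_T(x)^2 = |x|^2]. For minimality, the map of [limit_map_exists] turns out to be the
    identity, so every vector is a limit of elements of the span. *)
Lemma model_dilation_exists :
  exists (V : {linear Xt -> Xt}) (W : {linear X -> Xt}) (L : set Xt),
    isometric_dilation T V W L /\ minimal_dilation V W.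
Proof.
have [W WE] : exists W : {linear X -> Xt}, W =1 (fun x => mk x 0).
  apply: exists_linear => a x y.
  by apply: mk_eq; rewrite linearP ?p1mk ?p2mk ?scaler0 ?addr0.
have [V VE] : exists V : {linear Xt -> Xt},
    V =1 (fun u => mk (T (p1 u)) (l2_cons (p1 u : X0) (p2 u))).
  apply: exists_linear => a u v.
  apply: mk_eq; first by rewrite p1mk !linearP !p1mk.
  by rewrite p2mk !linearP !p2mk -l2_cons_linear.
pose L : set Xt := [set u | p1 u = 0].
have p1W x : p1 (W x) = x by rewrite WE p1mk.
have p2W x : p2 (W x) = 0 by rewrite WE p2mk.
have p1V u : p1 (V u) = T (p1 u) by rewrite VE p1mk.
have p2V u : p2 (V u) = l2_cons (p1 u : X0) (p2 u) by rewrite VE p2mk.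
have p1iterV n u : p1 (iter n V u) = iter n T (p1 u).
  by elim: n => [//|n IH]; rewrite !iterS p1V IH.
have decW u : u = W (p1 u) + mk 0 (p2 u).
  by apply: mk_eq; rewrite linearD ?p1W ?p2W ?p1mk ?p2mk ?addr0 ?add0r.
have hML : is_oplus2 (range W) L.
  split=> [u|_ l [x _ <-] l0].
    exists (W (p1 u), mk 0 (p2 u)); split.
      by split; [exists (p1 u)|exact: p1mk|exact: decW].
    move=> [w l] /= [[x _ <-] l0 ->].
    have l1 : p1 l = 0 by [].
    rewrite (linearD p1) (linearD p2) p1W p2W l1 addr0 add0r; congr pair.
    by apply: mk_eq; rewrite ?p1mk ?p2mk ?l1.
  rewrite !rnormE -!rmorphXn -rmorphD; congr (_%:C).
  have l1 : p1 l = 0 by [].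
  rewrite !sqr_rnormE !linearD p1W p2W l1.
  by rewrite addr0 add0r !rnorm0 expr0n addr0 add0r.
have hD : isometric_dilation T V W L.
  split=> //.
  - apply: isometryP => u; rewrite !sqr_rnormE p1V p2V.
    rewrite sqr_rnorm_l2_cons addrA; congr (_ + _).
    (* [Tle] makes the radicand of the defect nonnegative, so squaring undoes the root. *)
    rewrite [X in _ + X]sqr_sqrtr ?subr_ge0 ?lerXn2r ?nnegrE ?rnorm_ge0 //.
    by rewrite addrC subrK.
  - apply: isometryP => x; rewrite sqr_rnormE p1W p2W.
    by rewrite rnorm0 expr0n addr0.
  - split; last first.
      split; first by rewrite inE /L /= linear0.
      move=> a u v; rewrite !inE /L /= => u0 v0.
      by rewrite linearP u0 v0 scaler0 addr0.
    (* For [v] in [L], [|p1 u| = |p1 (u - v)| <= |u - v|], which can be made arbitrarily small. *)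
    move=> u /closure_rnormP cu; apply: rnorm_eq0.
    apply/eqP; rewrite eq_le rnorm_ge0 andbT; apply/ler_addgt0Pr => e /cu.
    move=> [v v0 /ltW uv]; rewrite add0r; apply: le_trans uv.
    have v1 : p1 v = 0 by [].
    by rewrite -[p1 u]subr0 -v1 -linearB.
  - move=> q _ [x _ <-].
    pose y := \sum_(i < size q) q`_i *: iter i T x.
    have -> : op_poly q (transport W T) (W x) = W y.
      rewrite linear_sum; apply: eq_bigr => i _.
      by rewrite linearZ iter_transport //; exact: can_inj p1W.
    have u1 : p1 (op_poly q V (W x)) = y.
      rewrite /op_poly linear_sum; apply: eq_bigr => i _.
      by rewrite linearZ /= p1iterV p1W.
    by rewrite [op_poly q V (W x)]decW u1 (proj_add hML).
exists V, W, L; split=> //.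
have [U [_ Ulim]] := limit_map_exists hD hA.
(* In the model [D y = (0, (y, 0, 0, ...))] and [V] shifts the second coordinate on [L], so the sum
   is [f] truncated to its first [n] entries. *)
have coord n (f : nat -> X0) k : p2 (wandering_sum T V W f n) k =
    if (k < n)%N then f k else 0.
  elim: n f k => [|n IH] f k; first by rewrite /wandering_sum big_ord0 linear0.
  rewrite wandering_sumSl linearD /wandering linearB !p2V p2W p1W.
  have -> : p1 (wandering_sum T V W (fun k => f k.+1) n) = 0.
    exact: (wandering_sum_in hD).
  rewrite !p2W; case: k => [|k] /=; first by rewrite subr0; exact: addr0.
  by rewrite subr0 ltnS -(IH (fun k => f k.+1)); exact: add0r.
apply/seteqP; split=> // u _.
have p1_contract v w : rnorm (p1 v - p1 w) <= rnorm (v - w).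
  by rewrite -linearB; exact: rnorm_p1_le.
have p2_contract v w : rnorm (p2 v - p2 w) <= rnorm (v - w).
  by rewrite -linearB; exact: rnorm_p2_le.
(* Limits are compared coordinatewise: [p1] is constant along the sums, and each entry of [p2] is
   eventually that of [p2 u]. *)
have Uu : U (p1 u, p2 u) = u.
  have limU := Ulim (p1 u) (p2 u).
  apply: mk_eq.
    apply: (norm_cvg_unique (cvg_contract p1_contract limU)) => /=.
    apply: cvg_near_cst; apply: nearW => n.
    by rewrite linearD p1W (wandering_sum_in hD _ _ : p1 _ = 0) addr0.
  apply: (cvg_l2_eq (cvg_contract p2_contract limU)) => k.
  by exists k.+1 => // n /= kn; rewrite linearD p2W add0r coord kn.
apply/closure_rnormP => e e0; rewrite -Uu.
have /cvg_rdistP/(_ e e0)/filter_ex[n hn] := Ulim (p1 u) (p2 u).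
exists (W (p1 u) + wandering_sum T V W (p2 u) n) => //.
exact: wandering_sum_in_span.
Qed.

End model_dilation.

(** * Completeness of the model and the theorem *)

Definition complete_of (R : realType) (E : normedModType R[i])
    (bE : is_banach E) : completeNormedModType R[i] :=
  HB.pack (NormedModule.sort E) (Uniform_isComplete.Build E bE).

Lemma model_dilation (R : realType) (X : completeNormedModType R[i])
    (T : {linear X -> X}) (hA : is_norm (defect T)) :
  (forall x, rnorm (T x) <= rnorm x) -> is_banach (renormed hA) ->
  exists (Xt : completeNormedModType R[i]) (V : {linear Xt -> Xt})
    (W : {linear X -> Xt}) (L : set Xt),
    isometric_dilation T V W L /\ minimal_dilation V W.
Proof.
move=> Tle bX0.
have bE : is_banach (oplus2 X (l2 (renormed hA))).
  by apply: banach_oplus2; [exact: cauchy_cvg|exact: banach_l2].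
exists (complete_of bE).
(* The projections enter through existentials, so the model is seen only through its coordinates. *)
have [p1 p1E] : exists p1 : {linear complete_of bE -> X}, p1 =1 fst.
  by apply: exists_linear.
have [p2 p2E] : exists p2 : {linear complete_of bE -> l2 (renormed hA)},
    p2 =1 snd.
  by apply: exists_linear.
apply: (@model_dilation_exists _ _ _ _ Tle hA p1 p2 pair).
- by move=> x f; rewrite p1E.
- by move=> x f; rewrite p2E.
- by move=> u; rewrite p1E p2E -surjective_pairing.
- by move=> u; rewrite p1E p2E; exact: sqr_rnorm_oplus2.
Qed.

(** The two norms are equivalent: [|T x| <= c |x|] gives [(1 - c^2) |x|^2 <= A_T(x)^2 <= |x|^2]. *)
Lemma banach_defect (R : realType) (X : completeNormedModType R[i])
    (T : X -> X) (hA : is_norm (defect T)) (c : R) : 0 <= c < 1 ->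
  (forall x, rnorm (T x) <= c * rnorm x) -> is_banach (renormed hA).
Proof.
move=> /andP[c0 c1] Tc.
have c2 : 0 < 1 - c ^+ 2 by rewrite subr_gt0 expr_lt1.
have T2 x : rnorm (T x) ^+ 2 <= c ^+ 2 * rnorm x ^+ 2.
  by rewrite -exprMn lerXn2r ?nnegrE ?mulr_ge0 ?rnorm_ge0.
have sqr_defect x : defect T x ^+ 2 = rnorm x ^+ 2 - rnorm (T x) ^+ 2.
  rewrite sqr_sqrtr // subr_ge0; apply: le_trans (T2 x) _.
  by rewrite ler_piMl ?sqr_ge0 // ltW // -subr_gt0.
apply: (@banach_renormed _ _ _ hA (Num.sqrt (1 - c ^+ 2))^-1 1).
- move=> x; rewrite mulrC ler_pdivlMr ?sqrtr_gt0 //.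
  rewrite -(@ler_pXn2r _ 2) ?nnegrE ?mulr_ge0 ?rnorm_ge0 ?sqrtr_ge0 //.
  rewrite exprMn sqr_sqrtr ?(ltW c2) // sqr_defect.
  by rewrite mulrBr mulr1 lerD2l lerN2 mulrC.
- move=> x; rewrite mul1r -(@ler_pXn2r _ 2) ?nnegrE ?rnorm_ge0 ?sqrtr_ge0 //.
  by rewrite sqr_defect gerBl sqr_ge0.
- exact: cauchy_cvg.
Qed.

Theorem theorem1p4 (R : realType) (X : completeNormedModType R[i])
    (T : {linear X -> X}) (hT : strict_contraction T) :
  (dilates_to_isometry T <-> is_norm (defect T)) /\
  (forall hA : is_norm (defect T),
     [/\ is_banach (renormed hA),
         exists (Xt : completeNormedModType R[i]) (V : {linear Xt -> Xt})
           (W : {linear X -> Xt}) (L : set Xt),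
           isometric_dilation T V W L /\ minimal_dilation V W &
         forall (Xt : completeNormedModType R[i]) (V : {linear Xt -> Xt})
           (W : {linear X -> Xt}) (L : set Xt),
           isometric_dilation T V W L -> minimal_dilation V W ->
           isometrically_isomorphic Xt (oplus2 X (l2 (renormed hA)))]).
Proof.
have [c c01 Tc] := strict_contraction_bound hT.
have Tle x : rnorm (T x) <= rnorm x.
  apply: le_trans (Tc x) _; case/andP: c01 => _ /ltW c1.
  by rewrite ler_piMl ?rnorm_ge0.
have banachA hA := banach_defect (hA := hA) c01 Tc.
split=> [|hA].
  split=> [[Xt [V [W [L hD]]]]|hA]; first exact: defect_is_norm hD c c01 Tc.
  have [Xt [V [W [L [hD _]]]]] := model_dilation Tle (banachA hA).
  by exists Xt, V, W, L.
split=> [||Xt V W L hD]; first exact: banachA.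
  exact: model_dilation.
exact: (minimal_dilation_isomorphic hD (banachA hA)).
Qed.
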